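(* Let $\alpha=(\alpha_1,\dots,\alpha_n)\in\mathbb{R}^n$ with $\alpha\neq 0$, and let $J$ be the reciprocal cost $$J(x_1,\dots,x_n)=\tfrac12\left(\prod_{i=1}^n x_i^{\alpha_i}+\prod_{i=1}^n x_i^{-\alpha_i}\right)-1,\qquad x=(x_1,\dots,x_n)\in(\mathbb{R}^+)^n .$$ Then: (i) In logarithmic coordinates $t_i=\log x_i$, the Hessian satisfies $\operatorname{rank}(\nabla^2 J(t))=1$ at every point. (ii) In the original $x$-coordinates, the Hessian $\nabla_x^2 J(x)$ is generically nondegenerate. More precisely, for fixed parameters $\alpha_i\neq 0$ (for all $i$), it is invertible on the open set where $R\neq 1$ and $$1+\beta\,u^{T}A^{-1}u\neq 0 .$$ The singular locus determined by the condition $$1+\beta\,u^{T}A^{-1}u=0,$$ which is equivalent to $$\tanh(S(x))=\sum_{i=1}^n\alpha_i,\qquad S(x)=\sum_{i=1}^n\alpha_i\log x_i,$$ exists (i.e. is nonempty) if and only if $$\left|\sum_{i=1}^n\alpha_i\right|<1 .$$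
   Context: $\mathbb{R}^+$ denotes the positive reals. In logarithmic coordinates $t=(t_1,\dots,t_n)\in\mathbb{R}^n$, $t_i=\log x_i$, the cost reads $J(t)=\cosh\left(\sum_{i=1}^n\alpha_i t_i\right)-1$, and $\nabla^2J(t)=\left(\frac{\partial^2 J}{\partial t_i\partial t_j}\right)_{i,j}$; in the original coordinates $\nabla_x^2J(x)=\left(\frac{\partial^2 J}{\partial x_i\partial x_j}\right)_{i,j}$. For $x\in(\mathbb{R}^+)^n$ set $R=R(x)=\prod_{k=1}^n x_k^{\alpha_k}$, let $u\in\mathbb{R}^n$ be the column vector with $u_i=\alpha_i/x_i$, $D=\mathrm{diag}(\alpha_1/x_1^2,\dots,\alpha_n/x_n^2)$, $A=-\tfrac12(R-R^{-1})D$, and $\beta=\tfrac12(R+R^{-1})$. The matrix $A$ is invertible when all $\alpha_i\neq0$ and $R\neq1$, and expressions involving $A^{-1}$ are considered under these restrictions.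
   Formalization: If the sum of the α_i is 0, the condition 1+β uᵀA⁻¹u=0 has no solution with R≠1 although |Σα_i|<1; so the existence criterion is proved for the form tanh S = Σα_i in general, and for the form with A⁻¹ only when Σα_i ≠ 0. *)

(* Defs.v *)
From HB Require Import structures.
From mathcomp Require Export all_boot all_order all_algebra.
From mathcomp Require Export all_classical all_reals all_analysis.

Set Implicit Arguments.
Unset Strict Implicit.
Unset Printing Implicit Defensive.

Import Order.TTheory GRing.Theory Num.Theory.
Import numFieldNormedType.Exports.

Local Open Scope classical_set_scope.
Local Open Scope ring_scope.

Section hyperbolic.
Variable R : realType.

Definition cosh (s : R) : R := (expR s + expR (- s)) / 2.
Definition tanh (s : R) : R := (expR s - expR (- s)) / (expR s + expR (- s)).

End hyperbolic.

(* Row i, column j holds d/dx_i (d f/dx_j), each partial derivative being the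
   directional derivative along a vector of the canonical basis. *)
Definition hessian (R : realType) (n : nat) (f : 'rV[R]_n -> R) (x : 'rV[R]_n) :
    'M[R]_n :=
  \matrix_(i, j) 'D_(delta_mx 0 i) (fun y => 'D_(delta_mx 0 j) f y) x.

Section reciprocal_cost.
Variables (R : realType) (n : nat) (alpha : 'rV[R]_n).

Definition orthant : set 'rV[R]_n := [set x | forall i, 0 < x 0 i].

(* powR is total; J is meaningful on the open set orthant only, and the
   partial derivatives at a point of orthant only depend on J near it. *)
Definition J (x : 'rV[R]_n) : R :=
  2^-1 * (\prod_(i < n) x 0 i `^ alpha 0 i
          + \prod_(i < n) x 0 i `^ (- alpha 0 i)) - 1.

(* J in the coordinates t_i = log x_i, i.e. x_i = exp t_i *)
Definition Jlog (t : 'rV[R]_n) : R := J (map_mx (@expR R) t).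

Lemma JlogE (t : 'rV[R]_n) : Jlog t = cosh (\sum_(i < n) alpha 0 i * t 0 i) - 1.
Proof.
have prodE (a : 'I_n -> R) :
    \prod_(i < n) (map_mx (@expR R) t) 0 i `^ a i
      = expR (\sum_(i < n) a i * t 0 i).
  by rewrite expR_sum; apply: eq_bigr => i _; rewrite mxE -expRM mulrC.
rewrite /Jlog /J /cosh !prodE [in RHS]mulrC; congr (_ * (_ + expR _) - 1).
by rewrite -sumrN; apply: eq_bigr => i _; rewrite mulNr.
Qed.

Definition Rmon (x : 'rV[R]_n) : R := \prod_(k < n) x 0 k `^ alpha 0 k.

Definition uvec (x : 'rV[R]_n) : 'cV[R]_n := \col_i (alpha 0 i / x 0 i).

Definition Dmat (x : 'rV[R]_n) : 'M[R]_n :=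
  diag_mx (\row_i (alpha 0 i / x 0 i ^+ 2)).

Definition Amat (x : 'rV[R]_n) : 'M[R]_n :=
  (- (2^-1 * (Rmon x - (Rmon x)^-1))) *: Dmat x.

Definition beta (x : 'rV[R]_n) : R := 2^-1 * (Rmon x + (Rmon x)^-1).

(* 1 + beta u^T A^-1 u; since invmx is total, this is to be used only where
   A is invertible, i.e. when all alpha_i are nonzero and Rmon x != 1. *)
Definition sm_factor (x : 'rV[R]_n) : R :=
  1 + beta x * ((uvec x)^T *m invmx (Amat x) *m uvec x) 0 0.

Definition Slog (x : 'rV[R]_n) : R := \sum_(i < n) alpha 0 i * ln (x 0 i).

Definition alpha_sum : R := \sum_(i < n) alpha 0 i.

Definition regular_set : set 'rV[R]_n :=
  [set x | [/\ orthant x, Rmon x != 1 & sm_factor x != 0]].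

(* The tanh form of the condition sm_factor x = 0 also makes sense on the
   hypersurface Rmon x = 1, where A is not invertible; it contains that
   hypersurface exactly when alpha_sum = 0. *)
Definition singular_locus : set 'rV[R]_n :=
  [set x | orthant x /\ tanh (Slog x) = alpha_sum].

End reciprocal_cost.

(* Main.v *)
(* With S = sum_i alpha_i log x_i one has J = cosh S - 1 on the orthant, so the
   chain rule gives cosh S alpha^T alpha for the Hessian in logarithmic
   coordinates, and H = cosh S u u^T - sinh S D in the original ones.  Since
   D x = u and u^T x = sigma := sum_i alpha_i, the point x itself satisfies
   H x = (sigma cosh S - sinh S) u; it is a kernel vector when tanh S = sigma,
   and when sinh S <> 0 every kernel vector is proportional to x.  The excluded
   points form at most two level sets of S, which gives density. *)
Require Import Defs.
From mathcomp Require Import all_boot all_order all_algebra.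
From mathcomp Require Import all_classical all_reals all_analysis.
From mathcomp Require Import ring lra.
Import Order.TTheory GRing.Theory Num.Theory.
Import numFieldNormedType.Exports.
Local Open Scope classical_set_scope.
Local Open Scope ring_scope.
Set Implicit Arguments.
Unset Strict Implicit.

(** * Calculus of directional derivatives of real-valued functions *)

Section directional_derivative.
Variables (R : realType) (V : normedModType R).

(** The two difference quotients are the same function of [h]; this lets one-variable rules be
    applied along the line through [x] with direction [v]. *)
Lemma is_derive_line (f : V -> R) (x v : V) (df : R) :
  is_derive x v f df <-> is_derive (0 : R) 1 (fun h => f (h *: v + x)) df.
Proof.
have E : (fun h : R => h^-1 *: ((f \o shift x) (h *: v) - f x)) =
    (fun h : R => h^-1 *: (((fun k => f (k *: v + x)) \o shift 0) (h *: 1)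
                            - f (0 *: v + x))).
  by apply/funext => h /=; rewrite addr0 scale0r add0r [h *: 1]mulr1.
by split=> -[dbl drv]; constructor; move: dbl drv; rewrite /derivable /derive E.
Qed.

(** On the line through [x] this is the one-variable chain rule, so directional derivatives of [f]
    suffice. *)
Lemma is_derive_comp_real (f : V -> R) (g : R -> R) (x v : V) (df dg : R) :
  is_derive x v f df -> is_derive (f x) 1 g dg ->
  is_derive x v (g \o f) (dg * df).
Proof.
move=> /is_derive_line df0 dgx; apply/is_derive_line.
have dg0 : is_derive ((fun h => f (h *: v + x)) (0 : R)) 1 g dg.
  by rewrite /= scale0r add0r.
exact: is_derive1_comp.
Qed.

End directional_derivative.

Lemma is_derive_coord (R : realType) (n : nat) (i : 'I_n) (x v : 'rV[R]_n) :
  is_derive x v (fun y : 'rV[R]_n => y 0 i) (v 0 i).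
Proof.
apply/is_derive_line.
under eq_fun do rewrite !mxE.
by apply: is_derive_eq; rewrite /GRing.scale /=; ring.
Qed.

Lemma is_derive_rsum (R : realType) (V : normedModType R) (n : nat)
    (f : 'I_n -> V -> R) (x v : V) (df : 'I_n -> R) :
  (forall i, is_derive x v (f i) (df i)) ->
  is_derive x v (fun y => \sum_(i < n) f i y) (\sum_(i < n) df i).
Proof.
move=> h; have -> : (fun y => \sum_(i < n) f i y) = \sum_(i < n) f i.
  by rewrite fct_sumE.
exact: is_derive_sum.
Qed.

(** * Hyperbolic functions and the equation [tanh s = c] *)

Section hyperbolic_functions.
Variable R : realType.
Implicit Types s c : R.

Definition sinh s : R := (expR s - expR (- s)) / 2.

Lemma is_derive_cosh s : is_derive s 1 (@cosh R) (sinh s).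
Proof.
rewrite /cosh /sinh; apply: is_derive_eq.
by rewrite /GRing.scale /=; ring.
Qed.

Lemma is_derive_sinh s : is_derive s 1 sinh (cosh s).
Proof.
rewrite /cosh /sinh; apply: is_derive_eq.
by rewrite /GRing.scale /=; ring.
Qed.

Lemma cosh_gt0 s : 0 < cosh s.
Proof. by rewrite divr_gt0// addr_gt0 ?expR_gt0. Qed.

Lemma tanhE s : tanh s = sinh s / cosh s.
Proof.
rewrite /tanh /sinh /cosh; field.
by rewrite ?gt_eqF// ?addr_gt0 ?expR_gt0//.
Qed.

Lemma sinh_eq0 s : (sinh s == 0) = (s == 0).
Proof.
rewrite /sinh mulf_eq0 invr_eq0 pnatr_eq0 orbF subr_eq0.
by rewrite (inj_eq (@expR_inj R)); apply/eqP/eqP => h; lra.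
Qed.

Lemma tanh_eq s c : (tanh s == c) = (sinh s == c * cosh s).
Proof.
have /lt0r_neq0 h := cosh_gt0 s; rewrite tanhE.
by apply/eqP/eqP => [<-|->]; rewrite ?mulfVK ?mulfK.
Qed.

Lemma tanh_norm_lt1 s : `|tanh s| < 1.
Proof.
have p := expR_gt0 s; have q := expR_gt0 (- s).
rewrite /tanh ltr_norml ltr_pdivlMr ?ltr_pdivrMr ?addr_gt0//; lra.
Qed.

Definition artanh c : R := ln ((1 + c) / (1 - c)) / 2.

(** Multiplying [tanh s = c] by its denominator and by [expR s] gives
    [expR s * expR s * (1 - c) = 1 + c], which has one solution since [1 + c] and [1 - c] are
    positive. *)
Lemma tanh_eq_artanh s c : `|c| < 1 -> (tanh s == c) = (s == artanh c).
Proof.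
rewrite ltr_norml => /andP[c1 c2].
have p1 : 0 < 1 + c by lra.
have p2 : 0 < 1 - c by lra.
have pq : 0 < (1 + c) / (1 - c) by rewrite divr_gt0.
have -> : (s == artanh c) = (expR (s + s) == (1 + c) / (1 - c)).
  rewrite -[(1 + c) / _]lnK// (inj_eq (@expR_inj R)) /artanh.
  by apply/eqP/eqP => [->|h]; lra.
have p := expR_gt0 s.
rewrite /tanh expRD expRN.
apply/eqP/eqP => h.
  have {}h : expR s - (expR s)^-1 = c * (expR s + (expR s)^-1).
    by rewrite -h mulfVK// lt0r_neq0// addr_gt0// invr_gt0.
  apply: (mulIf (lt0r_neq0 p2)); rewrite mulfVK ?lt0r_neq0//.
  move: h => /(congr1 ( *%R (expR s))).
  rewrite mulrBr mulrCA mulrDr mulfV ?lt0r_neq0// => h; lra.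
have {}h : expR s * expR s * (1 - c) = 1 + c by rewrite h mulfVK// lt0r_neq0.
have q : expR s != 0 by rewrite lt0r_neq0.
have nz : expR s + (expR s)^-1 != 0 by rewrite lt0r_neq0// addr_gt0// invr_gt0.
apply: (mulIf nz); rewrite mulfVK//; apply: (mulfI q).
rewrite mulrBr mulrCA mulrDr mulfV//; lra.
Qed.

(* When |c| >= 1 the equation has no solution, and the excluded value 0 is a
   harmless witness. *)
Lemma tanh_eq_ex c :
  exists s0 : R, forall s, s != 0 -> (tanh s == c) = (s == s0).
Proof.
have [c1|c1] := ltP `|c| 1.
  by exists (artanh c) => s _; exact: tanh_eq_artanh.
exists 0 => s /negbTE ->; apply/negP => /eqP sc.
by move: (tanh_norm_lt1 s); rewrite sc ltNge c1.
Qed.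

End hyperbolic_functions.

(** * Closed forms of the two Hessians *)

Section hessian_of_cost.
Variables (R : realType) (n : nat) (alpha : 'rV[R]_n).
Implicit Types x y t v : 'rV[R]_n.

Let e (i : 'I_n) : 'rV[R]_n := delta_mx 0 i.

Lemma hessian_Jlog t : let s := \sum_(i < n) alpha 0 i * t 0 i in
  hessian (Jlog alpha) t = cosh s *: (alpha^T *m alpha).
Proof.
pose L y := \sum_(i < n) alpha 0 i * y 0 i.
have dL y j : is_derive y (e j) L (alpha 0 j).
  apply: is_derive_eq.
    apply: is_derive_rsum => i.
    apply: (@is_deriveZ _ _ _ _ (alpha 0 i)); exact: is_derive_coord.
  rewrite /= (bigD1 j)//= big1 ?addr0 => [|i ij].
    by rewrite mxE !eqxx [_ *: _]mulr1.
  by rewrite mxE (negbTE ij) andbF scaler0.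
have dJ y j : 'D_(e j) (Jlog alpha) y = sinh (L y) * alpha 0 j.
  rewrite (_ : Jlog alpha = (@cosh R \o L) - cst 1); last first.
    by apply/funext => z; rewrite JlogE.
  apply: derive_val.
  apply: is_derive_eq.
    apply: is_deriveB.
    exact: is_derive_comp_real (dL _ _) (is_derive_cosh _).
  by rewrite subr0.
apply/matrixP => i j; rewrite !mxE big_ord1 !mxE.
(* The first partial has its closed form at every point, so it can be replaced as a function before
   differentiating again. *)
rewrite (_ : (fun y => _) = alpha 0 j *: (@sinh R \o L)); last first.
  by apply/funext => y; rewrite dJ mulrC.
apply: derive_val.
apply: is_derive_eq.
  apply: is_deriveZ.
  exact: is_derive_comp_real (dL _ _) (is_derive_sinh _).
by rewrite /GRing.scale /=; ring.
Qed.

(** The scalar [cosh s] is positive, and right multiplication by the nonzero row [alpha], which is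
    row free, preserves the rank of [alpha^T]. *)
Lemma rank_hessian_Jlog t :
  alpha != 0 -> \rank (hessian (Jlog alpha) t) = 1%N.
Proof.
move=> a0; rewrite hessian_Jlog mxrank_scale_nz ?lt0r_neq0 ?cosh_gt0//.
have ra : \rank alpha = 1%N by rewrite rank_rV a0.
by rewrite mxrankMfree ?mxrank_tr// /row_free ra.
Qed.

(** Finitely many open conditions hold together near [x]; hence formulas valid only on the orthant
    may be differentiated at its points. *)
Lemma near_orthant x : orthant x -> \forall y \near x, orthant y.
Proof.
move=> x0.
apply: (@filter_forall _ _ (fun i y => 0 < y 0 i) (nbhs x) (nbhs_filter x)) => i.
exact: (cvgr_gt (x 0 i) (@coord_continuous R 1 n 0 i x)).
Qed.

Lemma prod_powR (a : 'I_n -> R) x : orthant x ->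
  \prod_(i < n) x 0 i `^ a i = expR (\sum_(i < n) a i * ln (x 0 i)).
Proof.
move=> x0; rewrite expR_sum; apply: eq_bigr => i _.
by rewrite /powR gt_eqF.
Qed.

Lemma RmonE x : orthant x -> Rmon alpha x = expR (Slog alpha x).
Proof. exact: prod_powR. Qed.

Lemma JE x : orthant x -> J alpha x = cosh (Slog alpha x) - 1.
Proof.
move=> x0; rewrite /J /cosh !prod_powR// [in RHS]mulrC.
congr (_ * (_ + expR _) - 1).
by rewrite -sumrN; apply: eq_bigr => i _; rewrite mulNr.
Qed.

Lemma is_derive_Slog x j : orthant x ->
  is_derive x (e j) (Slog alpha) (alpha 0 j / x 0 j).
Proof.
move=> x0; apply: is_derive_eq.
  apply: is_derive_rsum => i.
  apply: (@is_deriveZ _ _ _ _ (alpha 0 i)).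
  apply: is_derive_comp_real; first exact: is_derive_coord.
  exact: is_derive1_ln.
rewrite /= (bigD1 j)//= big1 ?addr0 => [|i ij].
  by rewrite mxE !eqxx mulr1.
by rewrite mxE (negbTE ij) andbF mulr0 scaler0.
Qed.

Lemma derive_J x j : orthant x ->
  'D_(e j) (J alpha) x = sinh (Slog alpha x) * (alpha 0 j / x 0 j).
Proof.
move=> x0; rewrite (@near_eq_derive _ _ _ _ ((@cosh R \o Slog alpha) - cst 1)).
  apply: derive_val; apply: is_derive_eq.
    apply: is_deriveB.
    exact: is_derive_comp_real (is_derive_Slog _ _) (is_derive_cosh _).
  by rewrite subr0.
by apply: filterS (near_orthant x0) => y y0; rewrite JE.
Qed.

Lemma hessian_J x : orthant x ->
  hessian (J alpha) x =
    cosh (Slog alpha x) *: (uvec alpha x *m (uvec alpha x)^T)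
    - sinh (Slog alpha x) *: Dmat alpha x.
Proof.
move=> x0; apply/matrixP => i j; rewrite !mxE big_ord1 !mxE.
(* Here the first partial has its closed form only on the orthant, so it is replaced near [x] and
   then differentiated by the product rule. *)
rewrite (@near_eq_derive _ _ _ _
  ((@sinh R \o Slog alpha)
    * (alpha 0 j \*: (GRing.inv \o (fun y : 'rV[R]_n => y 0 j))))).
  apply: derive_val; apply: is_derive_eq.
    apply: is_deriveM.
      exact: is_derive_comp_real (is_derive_Slog _ _) (is_derive_sinh _).
    apply: is_deriveZ; apply: is_derive_comp_real; first exact: is_derive_coord.
    by apply: is_deriveV; exact: lt0r_neq0.
  rewrite /= /GRing.scale /= mxE eqxx /= eq_sym.
  have xi := lt0r_neq0 (x0 i); have xj := lt0r_neq0 (x0 j).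
  (* The factor [1 / x_j] depends on [x_i] only when [i = j], whence the diagonal term. *)
  by case: eqVneq => [->|_]; rewrite ?mulr1n ?mulr0n; field; rewrite ?xi ?xj.
by apply: filterS (near_orthant x0) => y y0; rewrite derive_J.
Qed.

End hessian_of_cost.

(** * Invertibility of the Hessian and the factor [sm_factor] *)

Section degeneracy.
Variables (R : realType) (n : nat) (alpha : 'rV[R]_n).
Implicit Types x : 'rV[R]_n.

Lemma Dmat_tr x : orthant x -> Dmat alpha x *m x^T = uvec alpha x.
Proof.
move=> x0; apply/matrixP => i j; rewrite ord1 mul_diag_mx !mxE.
by have := lt0r_neq0 (x0 i) => xi; field.
Qed.

Lemma uvec_dot x : orthant x ->
  (uvec alpha x)^T *m x^T = (alpha_sum alpha)%:M.
Proof.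
move=> x0; apply/matrixP => i j; rewrite !ord1 !mxE eqxx mulr1n.
apply: eq_bigr => k _; rewrite !mxE mulfVK// lt0r_neq0//; exact: x0.
Qed.

Lemma hessian_J_tr x : orthant x ->
  hessian (J alpha) x *m x^T =
    (alpha_sum alpha * cosh (Slog alpha x) - sinh (Slog alpha x))
      *: uvec alpha x.
Proof.
move=> x0; rewrite hessian_J// mulmxBl -!scalemxAl Dmat_tr// -mulmxA uvec_dot//.
by rewrite mul_mx_scalar scalerA scalerBl mulrC.
Qed.

(** The kernel vector [x^T] is nonzero because its coordinates are positive and there is at least
    one of them. *)
Lemma hessian_J_singular x : (0 < n)%N -> singular_locus alpha x ->
  hessian (J alpha) x \notin unitmx.
Proof.
move=> n0 [x0 /eqP]; rewrite tanh_eq => /eqP sx.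
apply/negP => Hu; have := hessian_J_tr x0.
rewrite sx subrr scale0r => /(congr1 (mulmx (invmx (hessian (J alpha) x)))).
rewrite mulKmx// mulmx0 => /matrixP/(_ (Ordinal n0) 0)/eqP.
by rewrite !mxE gt_eqF.
Qed.

Lemma hessian_J_unit x : (forall i, alpha 0 i != 0) -> orthant x ->
  Slog alpha x != 0 -> tanh (Slog alpha x) != alpha_sum alpha ->
  hessian (J alpha) x \in unitmx.
Proof.
move=> a0 x0 S0 T0; rewrite -row_free_unit -kermx_eq0.
apply/rowV0P => v /sub_kermxP.
rewrite hessian_J// mulmxBr -!scalemxAr mulmxA => /eqP; rewrite subr_eq0.
set s := Slog alpha x in S0 T0 *; set u := uvec alpha x.
have s0 : sinh s != 0 by rewrite sinh_eq0.
pose q := (v *m u) 0 0.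
rewrite [v *m u]mx11_scalar -/q.
move=> /eqP vq.
(* The kernel equation reads [cosh s * q * u^T = sinh s * v D]; cancelling the nonzero diagonal
   entries of [D] shows that [v] is a multiple of [x]. *)
have vE i : v 0 i = q * cosh s / sinh s * x 0 i.
  move: vq => /matrixP/(_ 0 i); rewrite mul_scalar_mx mul_mx_diag !mxE => vi.
  have xi := lt0r_neq0 (x0 i); have ai := a0 i.
  apply: (mulIf (mulf_neq0 s0 (mulf_neq0 ai (invr_neq0 (expf_neq0 2 xi))))).
  transitivity (sinh s * (v 0 i * (alpha 0 i / x 0 i ^+ 2))); first by ring.
  by rewrite -vi; field; rewrite ?s0 ?xi.
suff q0 : q = 0 by apply/rowP => i; rewrite vE q0 !mxE !mul0r.
(* Pairing this expression for [v] with [u] closes the loop: a nonzero [q] would force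
   [tanh s = alpha_sum alpha]. *)
have vu : q = q * cosh s / sinh s * alpha_sum alpha.
  rewrite {1}/q mxE mulr_sumr; apply: eq_bigr => i _.
  by rewrite vE mxE; have xi := lt0r_neq0 (x0 i); field; rewrite ?s0 ?xi.
move: T0; rewrite tanh_eq; apply: contraNeq => q0; apply/eqP.
apply: (mulfI q0); rewrite {1}vu; field; exact: s0.
Qed.

Hypothesis alpha_neq0 : forall i, alpha 0 i != 0.

Lemma Amat_scale x : orthant x ->
  Amat alpha x = - sinh (Slog alpha x) *: Dmat alpha x.
Proof. by move=> x0; rewrite /Amat RmonE// -expRN /sinh [in RHS]mulrC. Qed.

Lemma Amat_unit x : orthant x -> Slog alpha x != 0 -> Amat alpha x \in unitmx.
Proof.
move=> x0 S0; rewrite Amat_scale// unitmxE detZ det_diag unitrM unitrX ?unitfE.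
  apply/prodf_neq0 => i _; rewrite mxE mulf_neq0// invr_neq0// expf_neq0//.
  exact: lt0r_neq0 (x0 i).
by rewrite oppr_eq0 sinh_eq0.
Qed.

Lemma Rmon_neq1 x : orthant x -> (Rmon alpha x != 1) = (Slog alpha x != 0).
Proof. by move=> x0; rewrite RmonE// -expR0 (inj_eq (@expR_inj R)). Qed.

(* Since [D x = u] and [u^T x = alpha_sum], the vector [A^-1 u] is a multiple
   of [x]. *)
Lemma sm_factorE x : orthant x -> Slog alpha x != 0 ->
  sm_factor alpha x =
    1 - cosh (Slog alpha x) * alpha_sum alpha / sinh (Slog alpha x).
Proof.
move=> x0 S0; set s := Slog alpha x in S0 *.
have s0 : sinh s != 0 by rewrite sinh_eq0.
have Au : invmx (Amat alpha x) *m uvec alpha x = - (sinh s)^-1 *: x^T.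
  apply: (can_inj (mulKmx (Amat_unit x0 S0))).
  rewrite mulKVmx ?Amat_unit// -scalemxAr Amat_scale// -scalemxAl Dmat_tr//.
  by rewrite scalerA mulrNN mulVf// scale1r.
rewrite /sm_factor -mulmxA Au -scalemxAr uvec_dot// !mxE eqxx mulr1n.
have -> : beta alpha x = cosh s by rewrite /beta RmonE// -expRN mulrC.
by field.
Qed.

Lemma sm_factor_eq0 x : orthant x -> Slog alpha x != 0 ->
  (sm_factor alpha x == 0) = (tanh (Slog alpha x) == alpha_sum alpha).
Proof.
move=> x0 S0; rewrite sm_factorE// tanh_eq subr_eq0.
have s0 : sinh (Slog alpha x) != 0 by rewrite sinh_eq0.
rewrite -(inj_eq (mulIf s0)) mul1r mulfVK//.
by rewrite [in RHS]mulrC.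
Qed.

End degeneracy.

(** * Openness and density of the regular set; nonemptiness of the singular locus *)

Section regular_set_topology.
Variables (R : realType) (n : nat) (alpha : 'rV[R]_n).
Hypothesis alpha_neq0 : forall i, alpha 0 i != 0.
Implicit Types x : 'rV[R]_n.

Lemma regular_setP x : regular_set alpha x <->
  [/\ orthant x, Slog alpha x != 0 & tanh (Slog alpha x) != alpha_sum alpha].
Proof.
split=> -[x0 S0 T0].
  by move: S0 T0; rewrite Rmon_neq1// => S0; rewrite sm_factor_eq0.
by split; rewrite ?Rmon_neq1// sm_factor_eq0.
Qed.

(** Both exclusions take the form [Slog alpha x != c], so one argument serves each of them, for
    openness and for density. *)
Lemma regular_set_levels : exists s0 : R, forall x,
  regular_set alpha x <->
  [/\ orthant x, Slog alpha x != 0 & Slog alpha x != s0].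
Proof.
have [s0 s0P] := tanh_eq_ex (alpha_sum alpha); exists s0 => x.
rewrite regular_setP; split=> -[x0 S0 T0]; split=> //.
  by rewrite -s0P.
by rewrite s0P.
Qed.

Lemma continuous_Slog x : orthant x -> {for x, continuous (Slog alpha)}.
Proof.
move=> x0; apply: (cvg_big (@add_continuous R) (nbhs_filter x)) => i _.
 apply: cvgM; first exact: cvg_cst.
apply: (@continuous_comp _ _ _ (fun y : 'rV[R]_n => y 0 i) (@ln R)).
  exact: coord_continuous.
exact: continuous_ln.
Qed.

Lemma near_Slog_neq x (c : R) : orthant x -> Slog alpha x != c ->
  \forall y \near x, Slog alpha y != c.
Proof.
move=> x0 Sc; apply: (continuous_Slog x0 (t := [set s | s != c])).
exact: (open_nbhs_nbhs (conj (open_neq (y := c)) Sc)).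
Qed.

Lemma open_regular_set : open (regular_set alpha).
Proof.
have [s0 s0P] := regular_set_levels.
rewrite openE => x /s0P[x0 S0 Ss0]; rewrite /interior.
near=> y; apply/s0P; split; near: y.
- exact: near_orthant.
- exact: near_Slog_neq.
- exact: near_Slog_neq.
Unshelve. all: by end_near. Qed.

(** Along a coordinate line only the term [alpha_i ln(x_i + h)] of [Slog] varies, and it is
    injective in [h], so the level [c] is met at most once. *)
Lemma near_line_Slog_neq x (i : 'I_n) (c : R) : orthant x ->
  \forall h \near (0 : R)^',
    orthant (h *: delta_mx 0 i + x) ->
    Slog alpha (h *: delta_mx 0 i + x) != c.
Proof.
move=> x0.
(* The solution [h] of [Slog alpha x + alpha_i (ln (h + x_i) - ln x_i) = c]. *)
pose h0 := expR ((c - Slog alpha x) / alpha 0 i + ln (x 0 i)) - x 0 i.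
have : \forall h \near (0 : R)^', h != h0.
  (* If [x] itself lies on the level, then [h0 = 0], which the punctured neighbourhood excludes. *)
  have [->|h0n] := eqVneq h0 0; first exact: nbhs_dnbhs_neq.
  apply: nbhs_dnbhs; apply: (open_nbhs_nbhs (conj (open_neq (y := h0)) _)).
  by rewrite /= eq_sym.
apply: filterS => h hh0 y0; apply: contraNneq hh0 => Sc.
have := y0 i; rewrite !mxE !eqxx mulr1 => hx0.
have : Slog alpha (h *: delta_mx 0 i + x) =
    Slog alpha x + alpha 0 i * (ln (h + x 0 i) - ln (x 0 i)).
  rewrite /Slog (bigD1 i)//= [in RHS](bigD1 i)//= !mxE !eqxx mulr1.
  under eq_bigr => k ki do
    rewrite !mxE (negbTE ki) andbF mulr0 add0r.
  ring.
rewrite Sc /h0 => ->; rewrite [_ + _ - Slog _ _]addrAC subrr add0r.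
by rewrite mulrAC mulfV// mul1r subrK lnK// addrK.
Qed.

(** Moving from [x] along the [i]-th axis by a small nonzero [h] stays in the orthant and in the
    given neighbourhood, and avoids both excluded levels. *)
Lemma orthant_sub_closure (i : 'I_n) :
  @orthant R n `<=` closure (regular_set alpha).
Proof.
move=> x x0 B Bx; have [s0 s0P] := regular_set_levels.
have cx : (fun h : R => h *: delta_mx 0 i + x) @ (0 : R)^' --> x.
  apply: cvg_trans (_ : (fun h : R => h *: delta_mx 0 i + x) @ (0 : R) --> x).
    by apply: cvg_app; exact: nbhs_dnbhs.
  rewrite -[X in _ --> X]add0r -[X in X + _](scale0r (delta_mx 0 i)).
  by apply: cvgD; [apply: cvgZr_tmp; exact: cvg_id|exact: cvg_cst].
near (0 : R)^' => h.
have hx0 : orthant (h *: delta_mx 0 i + x).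
  by near: h; exact: cx (near_orthant x0).
exists (h *: delta_mx 0 i + x); split; last by near: h; exact: cx Bx.
apply/s0P; split=> //; move: hx0; near: h; exact: near_line_Slog_neq.
Unshelve. all: by end_near. Qed.

Lemma Slog_surj (i : 'I_n) (s : R) :
  exists2 x, orthant x & Slog alpha x = s.
Proof.
(* Coordinates equal to 1 contribute [ln 1 = 0], so the [i]-th one alone produces [s]. *)
exists (\row_k (if k == i then expR (s / alpha 0 i) else 1)).
  by move=> k; rewrite mxE; case: ifP => _; rewrite ?expR_gt0.
rewrite /Slog (bigD1 i)//= mxE eqxx expRK big1 ?addr0 => [|k ki].
  by rewrite mulrC mulfVK.
by rewrite mxE (negbTE ki) ln1 mulr0.
Qed.

(** The values of [tanh] have modulus below 1; conversely [Slog] is onto, so it attains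
    [artanh (alpha_sum alpha)]. *)
Lemma singular_locus_neq0 (i : 'I_n) :
  singular_locus alpha !=set0 <-> `|alpha_sum alpha| < 1.
Proof.
split=> [[x [_ <-]]|a1]; first exact: tanh_norm_lt1.
have [x x0 Sx] := Slog_surj i (artanh (alpha_sum alpha)).
by exists x; split=> //; rewrite Sx; apply/eqP; rewrite tanh_eq_artanh.
Qed.

End regular_set_topology.

Theorem theorem3p1 (R : realType) (n : nat) (alpha : 'rV[R]_n)
    (alpha_neq0 : alpha != 0) :
  (forall t : 'rV[R]_n, \rank (hessian (Jlog alpha) t) = 1%N) /\
  ((forall i : 'I_n, alpha 0 i != 0) ->
    [/\ open (regular_set alpha) /\
          @orthant R n `<=` closure (regular_set alpha),
        forall x : 'rV[R]_n, regular_set alpha x ->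
          hessian (J alpha) x \in unitmx,
        forall x : 'rV[R]_n, orthant x -> Rmon alpha x != 1 ->
          (sm_factor alpha x = 0 <-> tanh (Slog alpha x) = alpha_sum alpha),
        forall x : 'rV[R]_n, singular_locus alpha x ->
          hessian (J alpha) x \notin unitmx
      & (singular_locus alpha !=set0 <-> `|alpha_sum alpha| < 1) /\
        (alpha_sum alpha != 0 ->
          ((exists x : 'rV[R]_n,
              [/\ orthant x, Rmon alpha x != 1 & sm_factor alpha x = 0])
            <-> `|alpha_sum alpha| < 1))]).
Proof.
split=> [t|a0]; first exact: rank_hessian_Jlog.
have /rV0Pn[i _] := alpha_neq0.
have n0 : (0 < n)%N by case: (n) i => [[]|].
have smP x : orthant x -> Rmon alpha x != 1 ->
    (sm_factor alpha x = 0 <-> tanh (Slog alpha x) = alpha_sum alpha).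
  move=> x0; rewrite Rmon_neq1// => S0.
  by split=> /eqP h; apply/eqP; move: h; rewrite sm_factor_eq0.
split=> //.
- by split; [exact: open_regular_set | exact: orthant_sub_closure].
- by move=> x /(regular_setP a0)[x0 S0 T0]; exact: hessian_J_unit.
- by move=> x; exact: hessian_J_singular.
- split=> [|s0]; first exact: singular_locus_neq0.
  rewrite -(singular_locus_neq0 a0 i).
  split=> -[x]; first by move=> [x0 R1 /(smP _ x0 R1)]; exists x.
  move=> [x0 Tx]; exists x.
  (* On [Rmon alpha x = 1] one has [Slog alpha x = 0], so [tanh] vanishes there and cannot equal a
     nonzero [alpha_sum alpha]. *)
  have R1 : Rmon alpha x != 1.
    rewrite Rmon_neq1//; apply: contraNneq s0 => Sx.
    by rewrite -Tx Sx /tanh oppr0 subrr mul0r.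
  by split=> //; apply/smP.
Qed.
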